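(* Let $\mathcal{C}$ be a weak Waldhausen abelian category, and let $E$ be a class allowable for $\mathcal{C}$. Suppose $\mathcal{C}$ has enough $E$-projectives. If homotopy pushouts are well-defined in $\mathcal{C}$, then every object of $\mathcal{C}$ has $E$-projective dimension $0$ or $\infty$. In particular, homotopy cofibers are well-defined in $\mathcal{C}$ only if every object of $\mathcal{C}$ has $E$-projective dimension $0$ or $\infty$.
   Context: Let $\mathcal{C}$ be an abelian category. An allowable class $E$ in $\mathcal{C}$ is a collection of short exact sequences closed under isomorphism of short exact sequences and containing every short exact sequence in which at least one object is zero. A monomorphism $f:M\to N$ is an $E$-monomorphism if $0\to M\to N\to \mathrm{coker} f\to 0$ is in $E$; an epimorphism $g: M\to N$ is an $E$-epimorphism if $0\to\ker g\to M\to N\to 0$ is in $E$. An object $X$ is $E$-projective if every map $X\to N$ lifts through every $E$-epimorphism $M\to N$. $\mathcal{C}$ has enough $E$-projectives if every object $X$ admits an $E$-epimorphism $P\to X$ with $P$ $E$-projective. Maps $f,g:M\to N$ are $E$-stably equivalent ($f\simeq g$) if $f-g$ factors through an $E$-projective object. A map $f:M\to N$ is an $E$-stable equivalence if there is $h:N\to M$ with $f\circ h\simeq \mathrm{id}_N$ and $h\circ f\simeq\mathrm{id}_M$. A weak Waldhausen category is a category $\mathcal{C}$ with two subcategories $cof(\mathcal{C})$ (cofibrations) and $we(\mathcal{C})$ (weak equivalences), each containing all identity maps. A weak Waldhausen abelian category is an abelian category with the structure of a weak Waldhausen category such that there is an allowable class $E$ for which $we(\mathcal{C})$ is the class of $E$-stable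 equivalences and $cof(\mathcal{C})$ is the class of $E$-monomorphisms; such an $E$ is called allowable for $\mathcal{C}$. For a small category $\mathcal{D}$, a $\mathcal{D}$-indexed homotopy colimit diagram in $\mathcal{C}$ is a functor $F:\mathcal{D}\to\mathcal{C}$ such that $0\to F(X)$ is a cofibration for each object $X$ and $F(f)$ is a cofibration for each morphism $f$ of $\mathcal{D}$. If $\mathcal{C}$ has all $\mathcal{D}$-indexed colimits, $\mathcal{D}$-indexed homotopy colimits are well-defined in $\mathcal{C}$ if for every natural transformation $\phi:F\to G$ of $\mathcal{D}$-indexed homotopy colimit diagrams with each $\phi(X)$ a weak equivalence, the induced map $\mathrm{colim} F\to\mathrm{colim} G$ is a weak equivalence. Homotopy pushouts are the case where $\mathcal{D}$ has objects $A_0,A_1,A_2$ and non-identity maps only $A_0\to A_1$ and $A_0\to A_2$. Homotopy cofibers are the homotopy pushouts of homotopy colimit diagrams $F$ of this shape with $F(A_2)$ $E$-projective; they are well-defined in $\mathcal{C}$ if for every natural transformation $\phi: F\to G$ of homotopy colimit diagrams of this shape with $F(A_2)$ and $G(A_2)$ both $E$-projective and with each $\phi(A_i)$ ($i=0,1,2$) a weak equivalence, the induced map $\mathrm{colim} F\to\mathrm{colim} G$ is a weak equivalence. An $E$-projective resolution of $X$ is an exact sequence $\dots\to P_1\xrightarrow{f_1}P_0\xrightarrow{f_0}X\to 0$ with each $P_i$ $E$-projective and each $0\to\ker f_i\to P_i\to\mathrm{im} f_i\to 0$ in $E$. $X$ has $E$-projective dimension $\le n$ ($n\geq 0$) if it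 has an $E$-projective resolution with $P_i=0$ for $i>n$; it has $E$-projective dimension $n$ if it has $E$-projective dimension $\leq n$ but not $\leq n-1$, and $\infty$ if it has no finite $E$-projective dimension. *)

(* Defs.v *)
From HB Require Import structures.
From mathcomp Require Import all_boot ssralg.

Set Implicit Arguments.
Unset Strict Implicit.
Unset Printing Implicit Defensive.

Import GRing.Theory.
Local Open Scope ring_scope.

Declare Scope cat_scope.
Delimit Scope cat_scope with cat.
Local Open Scope cat_scope.

Record category := Category {
  ob :> Type;
  hom : ob -> ob -> Type;
  idm : forall X, hom X X;
  comp : forall X Y Z, hom Y Z -> hom X Y -> hom X Z;
  comp1m : forall X Y (f : hom X Y), comp (idm Y) f = f;
  compm1 : forall X Y (f : hom X Y), comp f (idm X) = f;
  compA : forall W X Y Z (h : hom Y Z) (g : hom X Y) (f : hom W X),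
    comp h (comp g f) = comp (comp h g) f }.

Arguments hom {c} X Y.
Arguments idm {c} X.
Arguments comp {c X Y Z} g f.

Notation "X ~> Y" := (hom X Y) (at level 60, no associativity) : cat_scope.
Notation "g \oc f" := (comp g f) (at level 40, left associativity) : cat_scope.

Record functor (D C : category) := Functor {
  fob :> D -> C;
  fmap : forall X Y : D, X ~> Y -> fob X ~> fob Y;
  fmap1 : forall X : D, fmap (idm X) = idm (fob X);
  fmapM : forall (X Y Z : D) (g : Y ~> Z) (f : X ~> Y),
    fmap (g \oc f) = fmap g \oc fmap f }.

Arguments fmap {D C} F {X Y} f : rename.

Record natTrans (D C : category) (F G : functor D C) := NatTrans {
  ntc :> forall X : D, F X ~> G X;
  ntcN : forall (X Y : D) (f : X ~> Y),
    ntc Y \oc fmap F f = fmap G f \oc ntc X }.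

Record cocone (D C : category) (F : functor D C) := Cocone {
  apex : C;
  leg : forall X : D, F X ~> apex;
  legN : forall (X Y : D) (f : X ~> Y), leg Y \oc fmap F f = leg X }.

Arguments apex {D C F} c.
Arguments leg {D C F} c X.

Definition is_colimit (D C : category) (F : functor D C) (c : cocone F) :=
  forall c' : cocone F,
    exists! u : apex c ~> apex c', forall X : D, u \oc leg c X = leg c' X.

Inductive span_ob := A0 | A1 | A2.

Definition span_hom (X Y : span_ob) : Type :=
  match X, Y with
  | A0, _ | A1, A1 | A2, A2 => unit
  | _, _ => Empty_set
  end.

Definition span_id (X : span_ob) : span_hom X X :=
  match X with A0 => tt | A1 => tt | A2 => tt end.

Definition span_comp (X Y Z : span_ob) :
  span_hom Y Z -> span_hom X Y -> span_hom X Z.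
Proof. by case: X; case: Y; case: Z. Defined.

Definition span : category.
Proof.
by refine (@Category span_ob span_hom span_id span_comp _ _ _);
  [case=> -[] [] | case=> -[] [] | case=> -[] [] [] [] [] []].
Defined.

Section Morphisms.
Variable C : category.

Definition monic (X Y : C) (f : X ~> Y) :=
  forall (W : C) (g h : W ~> X), f \oc g = f \oc h -> g = h.

Definition epic (X Y : C) (f : X ~> Y) :=
  forall (Z : C) (g h : Y ~> Z), g \oc f = h \oc f -> g = h.

Definition is_iso (X Y : C) (f : X ~> Y) :=
  exists g : Y ~> X, g \oc f = idm X /\ f \oc g = idm Y.

Definition is_zero_ob (Z : C) :=
  forall X : C, (exists! f : Z ~> X, True) /\ (exists! f : X ~> Z, True).

End Morphisms.

Record preadditive := Preadditive {
  pob :> Type;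
  phom : pob -> pob -> zmodType;
  pid : forall X, phom X X;
  pcomp : forall X Y Z, phom Y Z -> phom X Y -> phom X Z;
  pcomp1m : forall X Y (f : phom X Y), pcomp (pid Y) f = f;
  pcompm1 : forall X Y (f : phom X Y), pcomp f (pid X) = f;
  pcompA : forall W X Y Z (h : phom Y Z) (g : phom X Y) (f : phom W X),
    pcomp h (pcomp g f) = pcomp (pcomp h g) f;
  pcompDl : forall X Y Z (g g' : phom Y Z) (f : phom X Y),
    pcomp (g + g') f = pcomp g f + pcomp g' f;
  pcompDr : forall X Y Z (g : phom Y Z) (f f' : phom X Y),
    pcomp g (f + f') = pcomp g f + pcomp g f' }.

Canonical cat_of_preadditive (C : preadditive) : category :=
  @Category C (@phom C) (@pid C) (@pcomp C)
    (@pcomp1m C) (@pcompm1 C) (@pcompA C).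
Coercion cat_of_preadditive : preadditive >-> category.

HB.instance Definition _ (C : preadditive) (X Y : C) :=
  GRing.Zmodule.copy (@hom (cat_of_preadditive C) X Y) (phom X Y).

Section Preadditive.
Variable C : preadditive.

Definition is_kernel (X Y K : C) (f : X ~> Y) (k : K ~> X) :=
  f \oc k = 0 /\
  forall (W : C) (h : W ~> X), f \oc h = 0 -> exists! u : W ~> K, k \oc u = h.

Definition is_cokernel (X Y Q : C) (f : X ~> Y) (q : Y ~> Q) :=
  q \oc f = 0 /\
  forall (Z : C) (h : Y ~> Z), h \oc f = 0 -> exists! u : Q ~> Z, u \oc q = h.

Definition is_biproduct (X Y P : C) (i1 : X ~> P) (i2 : Y ~> P)
    (p1 : P ~> X) (p2 : P ~> Y) :=
  [/\ p1 \oc i1 = idm X, p2 \oc i2 = idm Y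
    & i1 \oc p1 + i2 \oc p2 = idm P].

(* [m] is the image of [f], i.e. a kernel of a cokernel of [f], and [e] is the
   factor of [f] through it *)
Definition is_image (X Y I : C) (f : X ~> Y) (m : I ~> Y) (e : X ~> I) :=
  (exists (Q : C) (q : Y ~> Q), is_cokernel f q /\ is_kernel q m) /\
  m \oc e = f.

Definition exact (X Y Z : C) (f : X ~> Y) (g : Y ~> Z) :=
  exists (I : C) (m : I ~> Y) (e : X ~> I), is_image f m e /\ is_kernel g m.

Definition short_exact (X Y Z : C) (f : X ~> Y) (g : Y ~> Z) :=
  [/\ monic f, exact f g & epic g].

End Preadditive.

Record abelianCategory := AbelianCategory {
  abcat :> preadditive;
  ab_zero : exists Z : abcat, is_zero_ob Z;
  ab_biprod : forall X Y : abcat,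
    exists (P : abcat) (i1 : X ~> P) (i2 : Y ~> P) (p1 : P ~> X) (p2 : P ~> Y),
      is_biproduct i1 i2 p1 p2;
  ab_ker : forall (X Y : abcat) (f : X ~> Y),
    exists (K : abcat) (k : K ~> X), is_kernel f k;
  ab_coker : forall (X Y : abcat) (f : X ~> Y),
    exists (Q : abcat) (q : Y ~> Q), is_cokernel f q;
  ab_monic : forall (X Y : abcat) (f : X ~> Y), monic f ->
    exists (Z : abcat) (g : Y ~> Z), is_kernel g f;
  ab_epic : forall (X Y : abcat) (f : X ~> Y), epic f ->
    exists (W : abcat) (g : W ~> X), is_cokernel g f }.

Section Allowable.
Variable C : abelianCategory.

Record ses := Ses {
  ses_sub : C;
  ses_mid : C;
  ses_quo : C;
  ses_i : ses_sub ~> ses_mid;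
  ses_p : ses_mid ~> ses_quo;
  ses_exact : short_exact ses_i ses_p }.

Definition ses_isomorphic (S T : ses) :=
  exists (a : ses_sub S ~> ses_sub T) (b : ses_mid S ~> ses_mid T)
         (c : ses_quo S ~> ses_quo T),
    [/\ is_iso a, is_iso b, is_iso c,
        b \oc ses_i S = ses_i T \oc a & c \oc ses_p S = ses_p T \oc b].

Definition allowable_class (E : ses -> Prop) :=
  (forall S T : ses, ses_isomorphic S T -> E S -> E T) /\
  (forall S : ses,
     [\/ is_zero_ob (ses_sub S), is_zero_ob (ses_mid S)
       | is_zero_ob (ses_quo S)] -> E S).

Variable E : ses -> Prop.

(* Kernels, cokernels and images are determined up to isomorphism only; since
   allowable classes are closed under isomorphism, "some" kernel (cokernel,
   image) below means the same as "any". *)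
Definition E_monic (M N : C) (f : M ~> N) :=
  monic f /\
  exists (Q : C) (q : N ~> Q) (H : short_exact f q),
    is_cokernel f q /\ E (Ses H).

Definition E_epic (M N : C) (g : M ~> N) :=
  epic g /\
  exists (K : C) (k : K ~> M) (H : short_exact k g),
    is_kernel g k /\ E (Ses H).

Definition E_projective (X : C) :=
  forall (M N : C) (g : M ~> N), E_epic g ->
  forall h : X ~> N, exists l : X ~> M, g \oc l = h.

Definition enough_E_projectives :=
  forall X : C, exists (P : C) (g : P ~> X), E_projective P /\ E_epic g.

Definition E_stably_equivalent (M N : C) (f g : M ~> N) :=
  exists (P : C) (u : M ~> P) (v : P ~> N),
    E_projective P /\ f - g = v \oc u.

Definition E_stable_equivalence (M N : C) (f : M ~> N) :=
  exists h : N ~> M,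
    E_stably_equivalent (f \oc h) (idm N) /\
    E_stably_equivalent (h \oc f) (idm M).

(* 0 -> ker f -> X -> im f -> 0 is in E *)
Definition E_ker_im (X Y : C) (f : X ~> Y) :=
  exists (K I : C) (k : K ~> X) (m : I ~> Y) (e : X ~> I)
         (H : short_exact k e),
    [/\ is_kernel f k, is_image f m e & E (Ses H)].

(* ... -> P 1 -> P 0 -> X -> 0, with f_0 the augmentation [aug] and f_(i+1)
   the differential [diff i] *)
Record E_resolution (X : C) := EResolution {
  res :> nat -> C;
  aug : res 0%N ~> X;
  diff : forall i : nat, res i.+1 ~> res i;
  aug_epic : epic aug;
  aug_exact : exact (diff 0) aug;
  diff_exact : forall i : nat, exact (diff i.+1) (diff i);
  res_projective : forall i : nat, E_projective (res i);
  aug_E : E_ker_im aug;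
  diff_E : forall i : nat, E_ker_im (diff i) }.

Definition E_pdim_le (X : C) (n : nat) :=
  exists P : E_resolution X, forall i : nat, (n < i)%N -> is_zero_ob (P i).

Definition E_pdim_eq (X : C) (n : nat) :=
  E_pdim_le X n /\ (if n is m.+1 then ~ E_pdim_le X m else True).

Definition E_pdim_infinite (X : C) := forall n : nat, ~ E_pdim_le X n.

End Allowable.

(* a subcategory containing all identity maps, as a class of morphisms *)
Record wideSubcategory (C : category) := WideSubcategory {
  in_sub : forall X Y : C, X ~> Y -> Prop;
  in_sub_id : forall X : C, in_sub (idm X);
  in_sub_comp : forall (X Y Z : C) (g : Y ~> Z) (f : X ~> Y),
    in_sub g -> in_sub f -> in_sub (g \oc f) }.

Record weakWaldhausen (C : category) := WeakWaldhausen {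
  cof : wideSubcategory C;
  we : wideSubcategory C }.

Definition cofibration (C : category) (W : weakWaldhausen C) (X Y : C)
  (f : X ~> Y) := in_sub (cof W) f.

Definition weak_equivalence (C : category) (W : weakWaldhausen C) (X Y : C)
  (f : X ~> Y) := in_sub (we W) f.

Definition allowable_for (C : abelianCategory) (W : weakWaldhausen C)
    (E : ses C -> Prop) :=
  [/\ allowable_class E,
      (forall (X Y : C) (f : X ~> Y),
         weak_equivalence W f <-> E_stable_equivalence E f)
    & (forall (X Y : C) (f : X ~> Y),
         cofibration W f <-> E_monic E f)].

Record weakWaldhausenAbelian := WeakWaldhausenAbelian {
  wwab :> abelianCategory;
  wwab_str :> weakWaldhausen wwab;
  wwab_allowable : exists E : ses wwab -> Prop, allowable_for wwab_str E }.

Section HomotopyColimits.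
Variable C : weakWaldhausenAbelian.

Definition hocolim_diagram (D : category) (F : functor D C) :=
  (forall (X : D) (Z : C), is_zero_ob Z -> cofibration C (0 : Z ~> F X)) /\
  (forall (X Y : D) (f : X ~> Y), cofibration C (fmap F f)).

(* [Q] restricts the class of homotopy colimit diagrams under consideration.
   The induced map on colimits is the unique [u] compatible with the legs. *)
Definition hocolims_well_defined_on (D : category) (Q : functor D C -> Prop) :=
  forall F G : functor D C,
    hocolim_diagram F -> hocolim_diagram G -> Q F -> Q G ->
  forall phi : natTrans F G, (forall X : D, weak_equivalence C (phi X)) ->
  forall (cF : cocone F) (cG : cocone G), is_colimit cF -> is_colimit cG ->
  forall u : apex cF ~> apex cG,
    (forall X : D, u \oc leg cF X = leg cG X \oc phi X) ->
  weak_equivalence C u.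

Definition hocolims_well_defined (D : category) :=
  @hocolims_well_defined_on D (fun _ => True).

Definition hopushouts_well_defined := hocolims_well_defined span.

Definition hocofibers_well_defined (E : ses C -> Prop) :=
  @hocolims_well_defined_on span (fun F => E_projective E (F A2)).

End HomotopyColimits.

(* Main.v *)
From Stdlib Require Import Classical.
From mathcomp Require Import all_boot ssralg.
Require Import Defs.

Set Implicit Arguments.
Unset Strict Implicit.
Unset Printing Implicit Defensive.

Import GRing.Theory.
Local Open Scope ring_scope.
Local Open Scope cat_scope.

(** The heart of the matter is that well-definedness of homotopy cofibers makes
    the cokernel of every [E]-monomorphism between [E]-projectives
    [E]-projective.
    Let [K -k-> P -e-> X] be in [E] with [K] and [P] projective. The pushout
    of [k] along itself is [P (+) X]: the fold map splits off one copy of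
    [P], with complement the cokernel [X] of [k]. The span [P <- K -> P] is a
    homotopy colimit diagram, and since a projective object is stably
    equivalent to zero, it maps by weak equivalences to the zero span. So the
    induced map [P (+) X -> 0] is a stable equivalence, which says that the
    identity of [P (+) X] factors through a projective; hence [X] is a retract
    of a projective, thus projective ([E_projective_coker]).

    Now let [X] have a finite resolution. Beyond its length the kernels of the
    differentials are zero, hence projective. If the kernel of a differential
    is projective then, by the closure property, so is its image, which is the
    kernel of the next map ([E_projective_image]). Descending to the
    augmentation shows that [X] is projective ([E_pdim_le_projective]), so
    that [X] resolves itself in length [0]. Homotopy cofibers are particular
    homotopy pushouts, so both claims follow. *)

(** * Elementary facts in preadditive categories *)

Section Preadditive.
Variable C : preadditive.

(** The bilinearity laws, restated on the morphisms of the underlying category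
   so that they rewrite terms built with [\oc]. *)
Lemma compDl (X Y Z : C) (g g' : Y ~> Z) (f : X ~> Y) :
  (g + g') \oc f = g \oc f + g' \oc f.
Proof. exact: pcompDl. Qed.

Lemma compDr (X Y Z : C) (g : Y ~> Z) (f f' : X ~> Y) :
  g \oc (f + f') = g \oc f + g \oc f'.
Proof. exact: pcompDr. Qed.

Lemma comp0m (X Y Z : C) (f : X ~> Y) : (0 : Y ~> Z) \oc f = 0.
Proof. by apply: (addrI ((0 : Y ~> Z) \oc f)); rewrite -compDl !addr0. Qed.

Lemma compm0 (X Y Z : C) (g : Y ~> Z) : g \oc (0 : X ~> Y) = 0.
Proof. by apply: (addrI (g \oc (0 : X ~> Y))); rewrite -compDr !addr0. Qed.

Lemma compNm (X Y Z : C) (g : Y ~> Z) (f : X ~> Y) : (- g) \oc f = - (g \oc f).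
Proof. by apply: (addrI (g \oc f)); rewrite -compDl !subrr comp0m. Qed.

Lemma zero_ob_id (Z : C) : is_zero_ob Z -> idm Z = 0.
Proof. by move=> /(_ Z) [[f [_ fU]] _]; rewrite -(fU (idm Z)) // (fU 0). Qed.

Lemma from_zero_id (Z X : C) (f : Z ~> X) : idm Z = 0 -> f = 0.
Proof. by move=> z; rewrite -[f]compm1 z compm0. Qed.

Lemma to_zero_id (Z X : C) (f : X ~> Z) : idm Z = 0 -> f = 0.
Proof. by move=> z; rewrite -[f]comp1m z comp0m. Qed.

Lemma monic_id (X : C) : monic (idm X).
Proof. by move=> W g h; rewrite !comp1m. Qed.

Lemma epic_id (X : C) : epic (idm X).
Proof. by move=> W g h; rewrite !compm1. Qed.

Lemma kernel_monic (X Y K : C) (f : X ~> Y) (k : K ~> X) :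
  is_kernel f k -> monic k.
Proof.
move=> [fk0 kU] W g h kgh.
have [|u [_ uU]] := kU W (k \oc g); first by rewrite compA fk0 comp0m.
by rewrite -(uU g) // (uU h).
Qed.

Lemma is_kernel_monic (X Y Z : C) (f : X ~> Y) :
  idm Z = 0 -> monic f -> is_kernel f (0 : Z ~> X).
Proof.
move=> z fm; split=> [|W h fh0]; first by rewrite compm0.
exists 0; split=> [|u _]; last by rewrite (to_zero_id u z).
by rewrite compm0; apply: fm; rewrite fh0 compm0.
Qed.

Lemma is_cokernel_epic (X Y Z : C) (f : X ~> Y) :
  idm Z = 0 -> epic f -> is_cokernel f (0 : Y ~> Z).
Proof.
move=> z fe; split=> [|W h hf0]; first by rewrite comp0m.
exists 0; split=> [|u _]; last by rewrite (from_zero_id u z).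
by rewrite comp0m; apply: fe; rewrite hf0 comp0m.
Qed.

Lemma is_kernel_zero (X Y : C) : is_kernel (0 : X ~> Y) (idm X).
Proof.
split=> [|W h _]; first by rewrite comp0m.
by exists h; split=> [|u]; rewrite comp1m.
Qed.

Lemma is_cokernel_zero (X Y : C) : is_cokernel (0 : X ~> Y) (idm Y).
Proof.
split=> [|W h _]; first by rewrite compm0.
by exists h; split=> [|u]; rewrite compm1.
Qed.

Lemma is_image_zero (X Y Z : C) (e : X ~> Z) :
  idm Z = 0 -> is_image (0 : X ~> Y) (0 : Z ~> Y) e.
Proof.
move=> z; split; last by rewrite comp0m.
exists Y, (idm Y); split; first exact: is_cokernel_zero.
by apply: is_kernel_monic => //; apply: monic_id.
Qed.

Lemma is_image_epic (X Y Z : C) (f : X ~> Y) :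
  idm Z = 0 -> epic f -> is_image f (idm Y) f.
Proof.
move=> z fe; split; last by rewrite comp1m.
exists Z, 0; split; first exact: is_cokernel_epic.
exact: is_kernel_zero.
Qed.

Lemma exact_zero_monic (X Y Z : C) (f : X ~> Y) :
  idm Z = 0 -> monic f -> exact (0 : Z ~> X) f.
Proof.
move=> z fm; exists Z, 0, (idm Z); split; first exact: is_image_zero.
exact: is_kernel_monic.
Qed.

Lemma exact_epic_zero (X Y Z : C) (f : X ~> Y) :
  idm Z = 0 -> epic f -> exact f (0 : Y ~> Z).
Proof.
move=> z fe; exists Y, (idm Y), f; split; first exact: is_image_epic z _.
exact: is_kernel_zero.
Qed.

Lemma monic_from_zero (X Z : C) (f : Z ~> X) : idm Z = 0 -> monic f.
Proof. by move=> z W g h _; rewrite (to_zero_id g z) (to_zero_id h z). Qed.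

Lemma epic_to_zero (X Z : C) (f : X ~> Z) : idm Z = 0 -> epic f.
Proof. by move=> z W g h _; rewrite (from_zero_id g z) (from_zero_id h z). Qed.

Lemma short_exact_zero_id (X Z : C) :
  idm Z = 0 -> short_exact (0 : Z ~> X) (idm X).
Proof.
move=> z; split; first exact: monic_from_zero.
  by apply: exact_zero_monic => //; apply: monic_id.
exact: epic_id.
Qed.

Lemma short_exact_id_zero (X Z : C) :
  idm Z = 0 -> short_exact (idm X) (0 : X ~> Z).
Proof.
move=> z; split; first exact: monic_id.
  by apply: exact_epic_zero => //; apply: epic_id.
exact: epic_to_zero.
Qed.

Definition is_retract (X Y : C) :=
  exists (i : X ~> Y) (r : Y ~> X), r \oc i = idm X.

Lemma kernel_retract (X Y K K' : C) (f : X ~> Y) (k : K ~> X) (k' : K' ~> X) :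
  is_kernel f k -> is_kernel f k' -> is_retract K K'.
Proof.
move=> kP [fk'0 k'U]; have [fk0 kU] := kP.
have [i [k'i _]] := k'U _ _ fk0; have [r [kr _]] := kU _ _ fk'0.
by exists i, r; apply: (kernel_monic kP); rewrite compA kr k'i compm1.
Qed.

(** The two images may be kernels of different cokernels of [f], but these
    factor through each other and so have the same kernels. *)
Lemma image_retract (X Y I I' : C) (f : X ~> Y)
    (m : I ~> Y) (e : X ~> I) (m' : I' ~> Y) (e' : X ~> I') :
  is_image f m e -> is_image f m' e' -> is_retract I I'.
Proof.
move=> [[Q [q [[qf0 qU] [qm0 mU]]]] _] [[Q' [q' [[q'f0 q'U] m'P]]] _].
apply: (@kernel_retract _ _ _ _ q' m m') => //; split.
  by have [u [<- _]] := qU _ _ q'f0; rewrite -compA qm0 compm0.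
move=> W h q'h0; apply: mU.
by have [u [<- _]] := q'U _ _ qf0; rewrite -compA q'h0 compm0.
Qed.

Lemma biproduct_p1i2 (X Y P : C) (i1 : X ~> P) (i2 : Y ~> P)
    (p1 : P ~> X) (p2 : P ~> Y) :
  is_biproduct i1 i2 p1 p2 -> p1 \oc i2 = 0.
Proof.
move=> [p1i1 p2i2 ip].
have: p1 \oc (i1 \oc p1 + i2 \oc p2) \oc i2 = p1 \oc i2 by rewrite ip compm1.
rewrite compDr compDl !compA p1i1 comp1m -!compA p2i2 compm1.
by rewrite -[RHS]addr0 => /addrI.
Qed.

Lemma biproduct_p2i1 (X Y P : C) (i1 : X ~> P) (i2 : Y ~> P)
    (p1 : P ~> X) (p2 : P ~> Y) :
  is_biproduct i1 i2 p1 p2 -> p2 \oc i1 = 0.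
Proof.
move=> [p1i1 p2i2 ip]; apply: (@biproduct_p1i2 Y X P i2 i1 p2 p1).
by split; rewrite // addrC.
Qed.

End Preadditive.

(** * Relative projectives in abelian categories *)

Section Abelian.
Variables (C : abelianCategory) (E : ses C -> Prop).
Hypothesis allowE : allowable_class E.

(** An epimorphism [e] is the cokernel of some [g], and [g] lands in the
    kernel of [e], which is the image of [k]; so whatever kills [k] also kills [g]. *)
Lemma short_exact_cokernel (K P X : C) (k : K ~> P) (e : P ~> X) :
  short_exact k e -> is_cokernel k e.
Proof.
move=> [_ [I [m [s [[[Q [q [[qk0 qU] [qm0 _]]]] ms]] [em0 mU]]]] ee].
split=> [|Z h hk0]; first by rewrite -ms compA em0 comp0m.
have [W [g [eg0 gU]]] := ab_epic ee; apply: gU.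
have [v [<- _]] := qU _ _ hk0; have [t [<- _]] := mU _ _ eg0.
by rewrite -compA (compA q) qm0 comp0m compm0.
Qed.

Lemma E_projective_retract (X Y : C) :
  is_retract X Y -> E_projective E Y -> E_projective E X.
Proof.
move=> [i [r ri]] projY M N g gE h; have [l gl] := projY _ _ g gE (h \oc r).
by exists (l \oc i); rewrite compA gl -compA ri compm1.
Qed.

Lemma E_projective_zero (Z : C) : idm Z = 0 -> E_projective E Z.
Proof.
by move=> z M N g _ h; exists 0; rewrite compm0 (from_zero_id h z).
Qed.

Lemma zero_E_monic (X Z : C) : is_zero_ob Z -> E_monic E (0 : Z ~> X).
Proof.
move=> z; have z0 := zero_ob_id z; split; first exact: monic_from_zero.
exists X, (idm X), (short_exact_zero_id X z0).
by split; [exact: is_cokernel_zero | apply: allowE.2; constructor 1].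
Qed.

Lemma E_stable_equivalence_to_zero (P Z : C) (f : P ~> Z) :
  idm Z = 0 -> E_projective E P -> E_stable_equivalence E f.
Proof.
move=> z projP; exists 0; split.
  exists Z, 0, 0; split; first exact: E_projective_zero.
  by rewrite z !compm0 subrr.
by exists P, (idm P), (- idm P); rewrite comp0m compm1 sub0r.
Qed.

(** A stable inverse of [B -> 0] exhibits the identity of [B] as a map that
    factors through a projective. *)
Lemma E_stable_equivalence_zero_projective (B Z : C) (f : B ~> Z) :
  idm Z = 0 -> E_stable_equivalence E f -> E_projective E B.
Proof.
move=> z [h [_ [P [u [v [projP hf]]]]]].
apply: E_projective_retract projP; exists u, (- v).
by rewrite compNm -hf (to_zero_id f z) compm0 sub0r opprK.
Qed.

Lemma E_projective_pdim_le (X : C) : E_projective E X -> E_pdim_le E X 0.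
Proof.
move=> projX; have [Z z] := ab_zero C; have z0 := zero_ob_id z.
pose r (i : nat) : C := if i is 0%N then X else Z.
have dE (Y : C) : E_ker_im E (0 : Z ~> Y).
  exists Z, Z, (idm Z), 0, 0, (short_exact_id_zero Z z0).
  split; [exact: is_kernel_zero | exact: is_image_zero |].
  by apply: allowE.2; constructor 1.
have aE : E_ker_im E (idm X).
  exists Z, X, 0, (idm X), (idm X), (short_exact_zero_id X z0).
  split; last by apply: allowE.2; constructor 1.
    exact: is_kernel_monic z0 (@monic_id _ _).
  exact: is_image_epic z0 (@epic_id _ _).
unshelve eexists (@EResolution C E X r (idm X) (fun i => 0) _ _ _ _ _ _).
- exact: epic_id.
- by apply: exact_zero_monic => //; apply: monic_id.
- by move=> i; apply: exact_zero_monic => //; apply: monic_from_zero.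
- by case=> [|i] //; apply: E_projective_zero.
- exact: aE.
- by move=> i; apply: dE.
by case.
Qed.

End Abelian.

(** * The pushout of a monomorphism along itself *)

Section DoubleSpan.
Variables (C : preadditive) (K P : C) (k : K ~> P).

Definition double_span_ob (S : span) : C := if S is A0 then K else P.

Definition double_span_map (S T : span) :
    S ~> T -> double_span_ob S ~> double_span_ob T :=
  match S, T return span_hom S T -> double_span_ob S ~> double_span_ob T with
  | A0, A0 => fun=> idm K
  | A0, A1 | A0, A2 => fun=> k
  | A1, A1 | A2, A2 => fun=> idm P
  | A1, A0 | A1, A2 | A2, A0 | A2, A1 => fun f => match f with end
  end.

Definition double_span : functor span C.
Proof.
refine (@Functor span C double_span_ob double_span_map _ _).
- by case.
- by move=> [] [] [] [] [] //=; rewrite ?comp1m ?compm1.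
Defined.

Variables (X B : C) (e : P ~> X).
Variables (i1 : P ~> B) (i2 : X ~> B) (p1 : B ~> P) (p2 : B ~> X).
Hypotheses (eP : is_cokernel k e) (BP : is_biproduct i1 i2 p1 p2).

Definition double_pushout_leg (S : span) : double_span S ~> B :=
  match S return double_span_ob S ~> B with
  | A0 => i1 \oc k
  | A1 => i1
  | A2 => i1 + i2 \oc e
  end.

Definition double_pushout : cocone double_span.
Proof.
refine (@Cocone _ _ double_span B double_pushout_leg _).
move=> [] [] [] //=; rewrite ?compm1 //.
by rewrite compDl -compA eP.1 compm0 addr0.
Defined.

(** Maps [a, b] that agree on [k] amount to [a] together with the factor of
    [b - a] through the cokernel [e], that is, to a map out of [P (+) X]. *)
Lemma double_pushout_colimit : is_colimit double_pushout.
Proof.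
have [p1i1 p2i2 ip] := BP.
have p1i2 := biproduct_p1i2 BP; have p2i1 := biproduct_p2i1 BP.
move=> c; set a : P ~> apex c := leg c A1; set b : P ~> apex c := leg c A2.
have ak : a \oc k = leg c A0 := @legN _ _ _ c A0 A1 tt.
have bk : b \oc k = leg c A0 := @legN _ _ _ c A0 A2 tt.
have [|d [de _]] := eP.2 _ (b - a).
  by rewrite compDl compNm ak bk subrr.
exists (a \oc p1 + d \oc p2); split.
  have ui1 : (a \oc p1 + d \oc p2) \oc i1 = a.
    by rewrite compDl -!compA p1i1 p2i1 compm1 compm0 addr0.
  have ui2 : (a \oc p1 + d \oc p2) \oc i2 = d.
    by rewrite compDl -!compA p1i2 p2i2 compm1 compm0 add0r.
  case=> /=; [by rewrite compA ui1 | exact: ui1 |].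
  by rewrite compDr compA ui1 ui2 de addrC subrK.
move=> u uP; have ui1 : u \oc i1 = a := uP A1.
have ui2 : u \oc i2 = d.
  have [|d' [_ d'U]] := eP.2 _ (b - a).
    by rewrite compDl compNm ak bk subrr.
  rewrite -(d'U d) //; symmetry; apply: d'U.
  by rewrite -[b](uP A2) /= compDr ui1 compA [a + _]addrC addrK.
by rewrite -[u]compm1 -ip compDr !compA ui1 ui2.
Qed.

End DoubleSpan.

Section ZeroSpan.
Variables (C : preadditive) (D : category) (Z : C).

Definition const_functor : functor D C.
Proof.
refine (@Functor D C (fun=> Z) (fun _ _ _ => idm Z) _ _) => //.
by move=> *; rewrite comp1m.
Defined.

Definition const_cocone : cocone const_functor.
Proof.
by refine (@Cocone _ _ const_functor Z (fun=> idm Z) _) => *; rewrite comp1m.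
Defined.

Hypothesis z : idm Z = 0.

Lemma const_zero_colimit : is_colimit const_cocone.
Proof.
move=> c; exists 0; split; last by move=> u _; rewrite (from_zero_id u z).
by move=> S; rewrite comp0m (from_zero_id (leg c S) z).
Qed.

Definition to_const_zero (F : functor D C) : natTrans F const_functor.
Proof.
refine (@NatTrans _ _ F const_functor (fun=> 0) _).
by move=> S T f; rewrite comp0m compm0.
Defined.

End ZeroSpan.

(** * Finite resolutions *)

Section Waldhausen.
Variables (C : weakWaldhausenAbelian) (E : ses C -> Prop).
Hypotheses (allowE : allowable_for C E) (hcof : hocofibers_well_defined E).

(** The two spans compared are [P <- K -> P] and the zero span; [P] is used at
    both ends so that both legs are [E]-monic and the third corner is
    projective, and [X] is then a summand of the pushout. *)
Lemma E_projective_coker (K P X : C) (k : K ~> P) (e : P ~> X)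
    (H : short_exact k e) :
  E (Ses H) -> E_projective E K -> E_projective E P -> E_projective E X.
Proof.
move=> EH projK projP; have [allow weE cofE] := allowE.
have [Z z] := ab_zero C; have z0 := zero_ob_id z.
have eP := short_exact_cokernel H.
have kE : E_monic E k by split; [case: H {EH} | exists X, e, H].
have [B [i1 [i2 [p1 [p2 BP]]]]] := ab_biprod P X.
have zero_cof (Y Z' : C) : is_zero_ob Z' -> cofibration C (0 : Z' ~> Y).
  by move=> z'; apply/cofE; apply: zero_E_monic.
have we_zero : weak_equivalence C (0 : B ~> Z).
  refine (@hcof (double_span k) (const_functor span Z) _ _ _ _
    (to_const_zero Z _) _ _ _ (double_pushout_colimit eP BP)
    (@const_zero_colimit _ _ _ z0) 0 _).
  - split=> [S Z'|]; first exact: zero_cof.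
    case=> -[] // [] //=; first [exact: in_sub_id | exact/cofE].
  - by split=> [S Z'|S T f]; [exact: zero_cof | exact: in_sub_id].
  - exact: projP.
  - exact: E_projective_zero.
  - by case=> /=; apply/weE; apply: E_stable_equivalence_to_zero.
  - by move=> S; rewrite comp0m compm0.
have [_ p2i2 _] := BP.
apply: (@E_projective_retract _ _ X B); first by exists i2, p2.
exact: E_stable_equivalence_zero_projective z0 ((weE _ _ _).1 we_zero).
Qed.

(** The sequence in [E] attached to [f] involves only some kernel and some
    image of [f]; any other ones are retracts of these, and projectivity
    passes to retracts. *)
Lemma E_projective_image (X Y K I : C) (f : X ~> Y) (k : K ~> X)
    (m : I ~> Y) (e : X ~> I) :
  E_ker_im E f -> E_projective E X -> is_kernel f k -> E_projective E K ->
  is_image f m e -> E_projective E I.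
Proof.
move=> [K' [I' [k' [m' [e' [H [k'P m'P EH]]]]]]] projX kP projK mP.
apply: E_projective_retract (image_retract mP m'P) _.
apply: E_projective_coker EH _ projX.
exact: E_projective_retract (kernel_retract k'P kP) projK.
Qed.

(** Projectivity of the kernels descends along the resolution, starting from
    the differential [P n.+1 -> P n], whose source is zero. *)
Lemma E_pdim_le_projective (X : C) (n : nat) :
  E_pdim_le E X n -> E_projective E X.
Proof.
move=> [P Pzero]; have [Z z] := ab_zero C; have z0 := zero_ob_id z.
pose projker (Y W : C) (f : Y ~> W) :=
  forall K (k : K ~> Y), is_kernel f k -> E_projective E K.
have projker_exact (Y W V : C) (f : Y ~> W) (g : W ~> V) :
    E_ker_im E f -> E_projective E Y -> exact f g -> projker _ _ f ->
    projker _ _ g.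
  move=> fE projY [I [m [e [mP mK]]]] fker K k kP.
  apply: E_projective_retract (kernel_retract kP mK) _.
  have [L [l lP]] := ab_ker f.
  exact: E_projective_image fE projY lP (fker _ _ lP) mP.
have projP i : E_projective E (P i) by exact: res_projective.
have ker_diffn : projker _ _ (diff P n).
  move=> K k kP; apply: E_projective_zero; apply: (kernel_monic kP).
  have Pz : idm (P n.+1) = 0 by apply: zero_ob_id; apply: Pzero.
  by rewrite (to_zero_id k Pz) !comp0m.
have ker_descend i : projker _ _ (diff P i) -> projker _ _ (diff P 0).
  elim: i => // i IHi keri; apply: IHi.
  exact: (projker_exact _ _ _ _ _ (diff_E P _) (projP _) (diff_exact P _) keri).
have ker_aug : projker _ _ (aug P).
  apply: (projker_exact _ _ _ _ _ (diff_E P 0) (projP _) (aug_exact P)).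
  exact: ker_descend ker_diffn.
have [K [k kP]] := ab_ker (aug P).
apply: E_projective_image (aug_E P) (projP 0%N) kP (ker_aug _ _ kP) _.
exact: is_image_epic z0 (@aug_epic _ _ _ P).
Qed.

Lemma E_pdim_zero_or_infinite (X : C) : E_pdim_eq E X 0 \/ E_pdim_infinite E X.
Proof.
have [allow _ _] := allowE.
have [[n Xn]|Xinf] := classic (exists n, E_pdim_le E X n); [left|right].
  by split=> //; apply: E_projective_pdim_le allow _ (E_pdim_le_projective Xn).
by move=> n Xn; apply: Xinf; exists n.
Qed.

End Waldhausen.

Theorem corollary3p11 (C : weakWaldhausenAbelian) (E : ses C -> Prop)
    (allowE : allowable_for C E) (enoughP : enough_E_projectives E) :
  (hopushouts_well_defined C ->
     forall X : C, E_pdim_eq E X 0 \/ E_pdim_infinite E X) /\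
  (hocofibers_well_defined E ->
     forall X : C, E_pdim_eq E X 0 \/ E_pdim_infinite E X).
Proof.
split=> [hpush|hcof]; last exact: E_pdim_zero_or_infinite.
apply: E_pdim_zero_or_infinite => // F G hF hG _ _; exact: hpush.
Qed.
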